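(* Consider the family of $E_7$-type fibrations $y^2=x^4+e\,x^2z^2+f\,xz^3+g\,z^4$, depending on a scalar parameter $C$, given by $$e=-6k^2+h,\qquad f=-2k(4k^2-h)+2C\phi,\qquad g=-k^2(3k^2-h)+2Ck\phi+C^2\gamma,$$ with $k,h,\phi,\gamma$ general sections of $\mathscr L,\mathscr L^2,\mathscr L^3,\mathscr L^4$ over the base $B$. Then, up to nonzero numerical constants and at leading order in $C$ as $C\to0$, the discriminant $\Delta$ and the $j$-invariant satisfy $$\Delta\sim C^2\,h^2(h-4k^2)(\phi^2-h\gamma),\qquad j\sim\frac1{C^2}\cdot\frac{h^4}{(h-4k^2)(\phi^2-h\gamma)}.$$
   Context: $\mathscr L$ is a line bundle on a nonsingular compact complex variety $B$. The Weierstrass model of the curve $y^2=x^4+e\,x^2z^2+f\,xz^3+g\,z^4$ is $y^2+x^3+Fx+G=0$ with $F=-4g-\frac13e^2$ and $G=-f^2+\frac83eg-\frac2{27}e^3$; its discriminant is $\Delta=4F^3+27G^2$ and its $j$-invariant is, up to a nonzero constant factor, $F^3/\Delta$. ''$\Delta\sim C^2A$ at leading order in $C$'' means that $\Delta$, as a polynomial in $C$, has the form (nonzero constant)$\,\cdot C^2A+O(C^3)$, and the statement for $j$ is understood as the quotient of the leading terms of $F^3$ and $\Delta$. *)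

(* Defs.v *)
From HB Require Import structures.
From mathcomp Require Import all_boot all_order all_algebra.
From mathcomp Require Import complex.
From mathcomp Require Import boolp classical_sets functions reals topology.
From mathcomp Require Import normedtype derive.

Set Implicit Arguments.
Unset Strict Implicit.
Unset Printing Implicit Defensive.

Import Order.TTheory GRing.Theory Num.Theory.
Import numFieldNormedType.Exports.

Local Open Scope classical_set_scope.
Local Open Scope complex_scope.
Local Open Scope ring_scope.

(* The complex numbers, packed as a numFieldType so that their canonical
   topology and norm are found. *)
Definition Cplx (R : realType) : numFieldType := R[i].

(* Differentiability over Cplx R is complex differentiability, so a
   differentiable map on an open subset of 'rV[Cplx R]_d is holomorphic.  A
   nonsingular compact complex variety is seen through its underlying compact
   connected complex manifold. *)
Record compact_complex_manifold (R : realType) (d : nat) := CompactComplexManifold {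
  space :> topologicalType;
  space_hausdorff : hausdorff_space space;
  space_compact : compact [set: space];
  space_connected : connected [set: space];
  space_nonempty : [set: space] !=set0;
  chart_index : Type;
  chart_dom : chart_index -> set space;
  chart : chart_index -> space -> 'rV[Cplx R]_d;
  chart_inv : chart_index -> 'rV[Cplx R]_d -> space;
  chart_dom_open : forall a, open (chart_dom a);
  chart_dom_cover : forall x, exists a, chart_dom a x;
  chart_img_open : forall a, open (chart a @` chart_dom a);
  chartK : forall a x, chart_dom a x -> chart_inv a (chart a x) = x;
  chart_continuous : forall a x, chart_dom a x -> {for x, continuous (chart a)};
  chart_inv_continuous : forall a x, chart_dom a x ->
    {for chart a x, continuous (chart_inv a)};
  chart_transition : forall a b x, chart_dom a x -> chart_dom b x ->
    differentiable (chart b \o chart_inv a) (chart a x)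
}.

Definition holomorphic_on (R : realType) (d : nat)
    (B : compact_complex_manifold R d) (W : set B) (f : B -> Cplx R) : Prop :=
  forall a x, chart_dom a x -> W x ->
    differentiable (f \o @chart_inv R d B a) (chart a x).

(* A holomorphic line bundle, given by a trivializing open cover and its
   cocycle of transition functions; the cocycle identities force
   trans i j x * trans j i x = 1, so the transition functions do not vanish. *)
Record line_bundle (R : realType) (d : nat) (B : compact_complex_manifold R d) :=
  LineBundle {
  triv_index : Type;
  triv_dom : triv_index -> set B;
  trans : triv_index -> triv_index -> B -> Cplx R;
  triv_dom_open : forall i, open (triv_dom i);
  triv_dom_cover : forall x, exists i, triv_dom i x;
  trans_holomorphic : forall i j,
    holomorphic_on (triv_dom i `&` triv_dom j) (trans i j);
  trans_id : forall i x, triv_dom i x -> trans i i x = 1;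
  trans_cocycle : forall i j k x,
    triv_dom i x -> triv_dom j x -> triv_dom k x ->
    trans i j x * trans j k x = trans i k x
}.

(* section L n is the space of global holomorphic sections of the n-th tensor
   power of L.  A section is the family of its expressions in the
   trivializations; [sec_out] only fixes the irrelevant values outside the
   trivializing open sets, so that Leibniz equality is equality of sections. *)
Record section (R : realType) (d : nat) (B : compact_complex_manifold R d)
    (L : line_bundle B) (n : nat) := Section {
  sec_val :> triv_index L -> B -> Cplx R;
  sec_out : forall i x, ~ triv_dom i x -> sec_val i x = 0;
  sec_holomorphic : forall i, holomorphic_on (triv_dom i) (sec_val i);
  sec_trans : forall i j x, triv_dom i x -> triv_dom j x ->
    sec_val i x = trans i j x ^+ n * sec_val j x
}.

Section SectionTheory.
Variables (R : realType) (d : nat) (B : compact_complex_manifold R d).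
Variable L : line_bundle B.

Lemma section_ext n (s t : section L n) :
  (forall i x, s i x = t i x) -> s = t.
Proof.
case: s t => [s s1 s2 s3] [t t1 t2 t3] /= st.
have {}st : s = t by apply/funext => i; apply/funext => x; exact: st.
subst t.
by rewrite (Prop_irrelevance s1 t1) (Prop_irrelevance s2 t2)
  (Prop_irrelevance s3 t3).
Qed.

Program Definition sec_zero n : section L n :=
  @Section R d B L n (fun _ _ => 0) _ _ _.
Next Obligation. by []. Qed.
Next Obligation. by move=> n i a x _ _; exact: differentiable_cst. Qed.
Next Obligation. by move=> n i j x _ _ /=; rewrite mulr0. Qed.

Program Definition sec_opp n (s : section L n) : section L n :=
  @Section R d B L n (fun i x => - s i x) _ _ _.
Next Obligation. by move=> n s i x /= /sec_out ->; rewrite oppr0. Qed.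
Next Obligation.
move=> n s i a x ax ix /=.
exact: differentiableN (sec_holomorphic s ax ix).
Qed.
Next Obligation. by move=> n s i j x ix jx /=; rewrite (sec_trans s ix jx) mulrN. Qed.

Program Definition sec_add n (s t : section L n) : section L n :=
  @Section R d B L n (fun i x => s i x + t i x) _ _ _.
Next Obligation. by move=> n s t i x /= ix; rewrite !sec_out ?addr0. Qed.
Next Obligation.
move=> n s t i a x ax ix /=.
exact: differentiableD (sec_holomorphic s ax ix) (sec_holomorphic t ax ix).
Qed.
Next Obligation.
move=> n s t i j x ix jx /=.
by rewrite (sec_trans s ix jx) (sec_trans t ix jx) mulrDr.
Qed.

Program Definition sec_scale n (c : Cplx R) (s : section L n) : section L n :=
  @Section R d B L n (fun i x => c * s i x) _ _ _.
Next Obligation. by move=> n c s i x /= /sec_out ->; rewrite mulr0. Qed.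
Next Obligation.
move=> n c s i a x ax ix /=.
exact: differentiableM (differentiable_cst _ _) (sec_holomorphic s ax ix).
Qed.
Next Obligation.
by move=> n c s i j x ix jx /=; rewrite (sec_trans s ix jx) mulrCA.
Qed.

Program Definition sec_mul m n (s : section L m) (t : section L n) :
    section L (m + n) :=
  @Section R d B L (m + n) (fun i x => s i x * t i x) _ _ _.
Next Obligation. by move=> m n s t i x /= /sec_out ->; rewrite mul0r. Qed.
Next Obligation.
move=> m n s t i a x ax ix /=.
exact: differentiableM (sec_holomorphic s ax ix) (sec_holomorphic t ax ix).
Qed.
Next Obligation.
move=> m n s t i j x ix jx /=.
by rewrite (sec_trans s ix jx) (sec_trans t ix jx) exprD mulrACA.
Qed.

HB.instance Definition _ n := gen_eqMixin (section L n).
HB.instance Definition _ n := gen_choiceMixin (section L n).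

Let sec_addA n : associative (@sec_add n).
Proof. by move=> s t u; apply: section_ext => i x /=; rewrite addrA. Qed.
Let sec_addC n : commutative (@sec_add n).
Proof. by move=> s t; apply: section_ext => i x /=; rewrite addrC. Qed.
Let sec_add0 n : left_id (sec_zero n) (@sec_add n).
Proof. by move=> s; apply: section_ext => i x /=; rewrite add0r. Qed.
Let sec_addN n : left_inverse (sec_zero n) (@sec_opp n) (@sec_add n).
Proof. by move=> s; apply: section_ext => i x /=; rewrite addNr. Qed.

HB.instance Definition _ n := GRing.isZmodule.Build (section L n)
  (@sec_addA n) (@sec_addC n) (@sec_add0 n) (@sec_addN n).

Let sec_scaleA n (a b : Cplx R) (s : section L n) :
  sec_scale a (sec_scale b s) = sec_scale (a * b) s.
Proof. by apply: section_ext => i x /=; rewrite mulrA. Qed.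
Let sec_scale1 n : left_id 1 (@sec_scale n).
Proof. by move=> s; apply: section_ext => i x /=; rewrite mul1r. Qed.
Let sec_scaleDr n : right_distributive (@sec_scale n) +%R.
Proof. by move=> a s t; apply: section_ext => i x /=; rewrite mulrDr. Qed.
Let sec_scaleDl n (s : section L n) : {morph (@sec_scale n)^~ s : a b / a + b}.
Proof. by move=> a b; apply: section_ext => i x /=; rewrite mulrDl. Qed.

HB.instance Definition _ n := GRing.Zmodule_isLmodule.Build (Cplx R) (section L n)
  (@sec_scaleA n) (@sec_scale1 n) (@sec_scaleDr n) (@sec_scaleDl n).

End SectionTheory.

Notation "s ⊗ t" := (sec_mul s t)
  (at level 40, left associativity) : ring_scope.

(* Zariski topology of a (possibly given without basis) complex vector space:
   polynomial functions are generated by constants and linear functionals. *)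
Inductive polynomial_function (K : fieldType) (V : lmodType K) : (V -> K) -> Prop :=
| polynomial_cst (c : K) : polynomial_function (fun _ : V => c)
| polynomial_lin (l : {linear V -> K^o}) : polynomial_function (fun v => l v)
| polynomial_add (p q : V -> K) : polynomial_function p ->
    polynomial_function q -> polynomial_function (fun v => p v + q v)
| polynomial_mul (p q : V -> K) : polynomial_function p ->
    polynomial_function q -> polynomial_function (fun v => p v * q v).

Definition zariski_open (K : fieldType) (V : lmodType K) (U : set V) : Prop :=
  exists S : set (V -> K), (forall p, S p -> polynomial_function p) /\
    forall v, U v <-> exists p, S p /\ p v != 0.

(* A nonempty Zariski open subset of a complex vector space is dense. *)
Definition for_general (K : fieldType) (V : lmodType K) (P : V -> Prop) : Prop :=
  exists U : set V, [/\ zariski_open U, U !=set0 & forall v, U v -> P v].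

(* The coefficients of the fibration y^2 = x^4 + e x^2 z^2 + f x z^3 + g z^4. *)
Record E7_fibration (R : realType) (d : nat) (B : compact_complex_manifold R d)
    (L : line_bundle B) := E7Fibration {
  E7_e : section L 2;
  E7_f : section L 3;
  E7_g : section L 4
}.

Section Weierstrass.
Variables (R : realType) (d : nat) (B : compact_complex_manifold R d).
Variable L : line_bundle B.

(* Weierstrass model y^2 + x^3 + F x + G = 0. *)
Definition weierstrass_F (Y : E7_fibration L) : section L 4 :=
  let: E7Fibration e f g := Y in
  - 4%:R *: g - 3%:R^-1 *: (e ⊗ e).

Definition weierstrass_G (Y : E7_fibration L) : section L 6 :=
  let: E7Fibration e f g := Y in
  - (f ⊗ f) + (8%:R / 3%:R) *: (e ⊗ g) - (2%:R / 27%:R) *: (e ⊗ e ⊗ e).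

Definition F_cubed (Y : E7_fibration L) : section L 12 :=
  weierstrass_F Y ⊗ weierstrass_F Y ⊗ weierstrass_F Y.

Definition discriminant (Y : E7_fibration L) : section L 12 :=
  4%:R *: F_cubed Y + 27%:R *: (weierstrass_G Y ⊗ weierstrass_G Y).

Definition E7_family (k : section L 1) (h : section L 2) (phi : section L 3)
    (gamma : section L 4) (C : Cplx R) : E7_fibration L :=
  E7Fibration
    (- 6%:R *: (k ⊗ k) + h)
    (- 2%:R *: (k ⊗ (4%:R *: (k ⊗ k) - h)) + (2%:R * C) *: phi)
    (- (k ⊗ k ⊗ (3%:R *: (k ⊗ k) - h)) + (2%:R * C) *: (k ⊗ phi)
       + C ^+ 2 *: gamma).

(* P C = C^m a + O(C^(m+1)), where P is polynomial in C. *)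
Definition leading_order (n : nat) (P : Cplx R -> section L n) (m : nat)
    (a : section L n) : Prop :=
  exists (N : nat) (r : nat -> section L n), forall C : Cplx R,
    P C = C ^+ m *: a + \sum_(l < N) C ^+ (m.+1 + l) *: r l.

(* Equality a / b = a' / b' of meromorphic functions on B, given as quotients
   of two sections of the same line bundle. *)
Definition meromorphic_eq (m n : nat) (a b : section L m) (a' b' : section L n)
    : Prop :=
  [/\ b != 0, b' != 0 & forall i x, a i x * b' i x = a' i x * b i x].

(* The quotient of the leading terms C^p a of P and C^q b of Q is the family of
   meromorphic functions P' C / Q' C. *)
Definition quotient_leading_order (m n : nat) (P Q : Cplx R -> section L m)
    (P' Q' : Cplx R -> section L n) : Prop :=
  exists (p q : nat) (a b : section L m),
    [/\ a != 0 /\ leading_order P p a,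
        b != 0 /\ leading_order Q q b &
        forall C : Cplx R, C != 0 ->
          meromorphic_eq (C ^+ p *: a) (C ^+ q *: b) (P' C) (Q' C)].

(* The residual factor (h - 4 k^2) (phi^2 - h gamma). *)
Definition residual (k : section L 1) (h : section L 2) (phi : section L 3)
    (gamma : section L 4) : section L 8 :=
  (h - 4%:R *: (k ⊗ k)) ⊗ (phi ⊗ phi - h ⊗ gamma).

Definition discriminant_asymptotics (c : Cplx R) (k : section L 1)
    (h : section L 2) (phi : section L 3) (gamma : section L 4) : Prop :=
  leading_order (fun C => discriminant (E7_family k h phi gamma C)) 2
    (c *: (h ⊗ h ⊗ residual k h phi gamma)).

Definition j_asymptotics (c : Cplx R) (k : section L 1)
    (h : section L 2) (phi : section L 3) (gamma : section L 4) : Prop :=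
  quotient_leading_order
    (fun C => F_cubed (E7_family k h phi gamma C))
    (fun C => discriminant (E7_family k h phi gamma C))
    (fun _ => c *: (h ⊗ h ⊗ h ⊗ h))
    (fun C => C ^+ 2 *: residual k h phi gamma).

End Weierstrass.

(* Main.v *)
From HB Require Import structures.
Require Import Defs.
From mathcomp Require Import all_boot all_order all_algebra.
From mathcomp Require Import boolp classical_sets functions reals topology.
From mathcomp Require Import normedtype derive.
From mathcomp Require Import ring.

Import Order.TTheory GRing.Theory Num.Theory.
Local Open Scope ring_scope.

(** At [C = 0] the quartic (with [z = 1]) is
    [(x + k)^2 (x^2 - 2 k x - 3 k^2 + h)]; hence [F = - h^2 / 3 + O(C)] and
    [G = - 2 h^3 / 27 + O(C)], and the terms of order [C^0] and [C^1] of
    [4 F^3 + 27 G^2] cancel.  All identities between sections are checked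
    pointwise in a trivialization, where they are polynomial identities over the
    complex field.  The evaluation of [h^2 (h - 4 k^2) (phi^2 - h gamma)] at
    a point is a polynomial function of [(k, h, phi, gamma)], so its
    nonvanishing is a Zariski open condition. *)

(** The predicate is generated by sums and products only, so subtraction enters through
    multiplication by the constant [-1]. *)
Lemma polynomial_opp (K : fieldType) (V : lmodType K) (p : V -> K) :
  polynomial_function p -> polynomial_function (fun v => - p v).
Proof.
move=> Pp; under eq_fun do rewrite -mulN1r.
exact: polynomial_mul (polynomial_cst _ _) Pp.
Qed.

Section SectionEvaluation.
Variables (R : realType) (d : nat) (B : compact_complex_manifold R d).
Variable L : line_bundle B.

Lemma sec_valZ n c (s : section L n) i x : (c *: s) i x = c * s i x.
Proof. by []. Qed.

Lemma sec_valM m n (s : section L m) (t : section L n) i x :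
  (s ⊗ t) i x = s i x * t i x.
Proof. by []. Qed.

Lemma sec_neq0P n (s : section L n) :
  reflect (exists i x, s i x != 0) (s != 0).
Proof.
apply: (iffP idP) => [s0|[i [x]]]; last by apply: contra => /eqP ->.
apply: contrapT => ns; move/negP: s0; apply; apply/eqP.
apply: section_ext => i x; apply/eqP/negPn/negP => six.
by apply: ns; exists i, x.
Qed.

(** The codomain is the regular module [(Cplx R)^o], so that evaluation at a point is a linear
    functional as [polynomial_lin] expects. *)
Definition sec_eval n i x (s : section L n) : (Cplx R)^o := s i x.

Lemma sec_eval_linear n i x : linear (sec_eval n i x).
Proof. by []. Qed.

HB.instance Definition _ n i x :=
  GRing.isLinear.Build (Cplx R) (section L n) (Cplx R)^o *:%R
    (sec_eval n i x) (sec_eval_linear n i x).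

Lemma polynomial_sec_val (V : lmodType (Cplx R)) n
    (l : {linear V -> section L n}) i x :
  polynomial_function (fun v : V => l v i x).
Proof. exact: (polynomial_lin (sec_eval n i x \o l)). Qed.

End SectionEvaluation.

Section LeadingTerms.
Variables (R : realType) (d : nat) (B : compact_complex_manifold R d).
Variables (L : line_bundle B) (k : section L 1) (h : section L 2).
Variables (phi : section L 3) (gamma : section L 4).

(** Since [e] is free of [C], [f] has degree 1 and [g] degree 2, both [F] and [G] are quadratic in
    [C]; these are their coefficients. *)
Let F0 : section L 4 := - 3%:R^-1 *: (h ⊗ h).
Let F1 : section L 4 := - 8%:R *: (k ⊗ phi).
Let F2 : section L 4 := - 4%:R *: gamma.
Let G0 : section L 6 := - (2%:R / 27%:R) *: (h ⊗ h ⊗ h).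
Let G1 : section L 6 := - (8%:R / 3%:R) *: (h ⊗ (k ⊗ phi)).
Let G2 : section L 6 :=
  - 4%:R *: (phi ⊗ phi) + (8%:R / 3%:R) *: ((h - 6%:R *: (k ⊗ k)) ⊗ gamma).

Lemma weierstrass_F_family C :
  weierstrass_F (E7_family k h phi gamma C) = F0 + C *: F1 + C ^+ 2 *: F2.
Proof.
by apply: section_ext => i x; rewrite [LHS]/= [RHS]/=; field; rewrite ?pnatr_eq0.
Qed.

Lemma weierstrass_G_family C :
  weierstrass_G (E7_family k h phi gamma C) = G0 + C *: G1 + C ^+ 2 *: G2.
Proof.
by apply: section_ext => i x; rewrite [LHS]/= [RHS]/=; field; rewrite ?pnatr_eq0.
Qed.

Lemma F_cubed_leading_order :
  leading_order (fun C => F_cubed (E7_family k h phi gamma C)) 0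
    (- 27%:R^-1 *: (h ⊗ h ⊗ h ⊗ h ⊗ h ⊗ h)).
Proof.
(* Coefficients of [C ^+ 1] to [C ^+ 6] in the cube of [F0 + C F1 + C^2 F2]. *)
pose r : seq (section L 12) :=
  [:: 3%:R *: (F0 ⊗ F0 ⊗ F1);
      3%:R *: (F0 ⊗ F1 ⊗ F1) + 3%:R *: (F0 ⊗ F0 ⊗ F2);
      F1 ⊗ F1 ⊗ F1 + 6%:R *: (F0 ⊗ F1 ⊗ F2);
      3%:R *: (F1 ⊗ F1 ⊗ F2) + 3%:R *: (F0 ⊗ F2 ⊗ F2);
      3%:R *: (F1 ⊗ F2 ⊗ F2);
      F2 ⊗ F2 ⊗ F2].
exists 6%N, (nth 0 r) => C; rewrite /F_cubed weierstrass_F_family.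
apply: section_ext => i x.
rewrite !big_ord_recl big_ord0 [LHS]/= [RHS]/=.
by field; rewrite ?pnatr_eq0.
Qed.

(** The [C ^+ 2] coefficient [12 (F0 F1^2 + F0^2 F2) + 27 (G1^2 + 2 G0 G2)] factors as
    [16 h^2 (h - 4 k^2) (phi^2 - h gamma)]. *)
Lemma discriminant_leading_order : discriminant_asymptotics 16%:R k h phi gamma.
Proof.
(* Coefficients of [C ^+ 3] to [C ^+ 6]; [27 G^2] stops at [C ^+ 4], so the last two come from
   [4 F^3] alone. *)
pose r : seq (section L 12) :=
  [:: 4%:R *: (F1 ⊗ F1 ⊗ F1) + 24%:R *: (F0 ⊗ F1 ⊗ F2)
        + 54%:R *: (G1 ⊗ G2);
      12%:R *: (F1 ⊗ F1 ⊗ F2) + 12%:R *: (F0 ⊗ F2 ⊗ F2)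
        + 27%:R *: (G2 ⊗ G2);
      12%:R *: (F1 ⊗ F2 ⊗ F2);
      4%:R *: (F2 ⊗ F2 ⊗ F2)].
exists 4%N, (nth 0 r) => C.
rewrite /discriminant /F_cubed weierstrass_F_family weierstrass_G_family.
apply: section_ext => i x.
rewrite !big_ord_recl big_ord0 [LHS]/= [RHS]/=.
by field; rewrite ?pnatr_eq0.
Qed.

(** Dividing [- h^6 / 27] by [16 C^2 h^2] times the residual cancels [h^2] and leaves the constant
    [(-1/27) / 16 = -1/432]. *)
Lemma j_leading_order : h ⊗ h ⊗ residual k h phi gamma != 0 ->
  j_asymptotics (- 432%:R^-1) k h phi gamma.
Proof.
(* One point where [h] and the residual are both nonzero witnesses all four nonvanishing conditions
   below. *)
move=> /sec_neq0P[i [x hres]].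
have [hx resx] : h i x != 0 /\ residual k h phi gamma i x != 0.
  by move: hres; rewrite !sec_valM !mulf_eq0 !negb_or => /andP[/andP[]].
exists 0%N, 2%N, (- 27%:R^-1 *: (h ⊗ h ⊗ h ⊗ h ⊗ h ⊗ h)),
  (16%:R *: (h ⊗ h ⊗ residual k h phi gamma)).
have c27 : - 27%:R^-1 != 0 :> Cplx R by rewrite oppr_eq0 invr_eq0 pnatr_eq0.
have c16 : 16%:R != 0 :> Cplx R by rewrite pnatr_eq0.
split.
- split; last exact: F_cubed_leading_order.
  by apply/sec_neq0P; exists i, x; rewrite sec_valZ !sec_valM !mulf_neq0.
- split; last exact: discriminant_leading_order.
  by apply/sec_neq0P; exists i, x; rewrite sec_valZ mulf_neq0.
move=> C C0; split.
- apply/sec_neq0P; exists i, x; rewrite !sec_valZ.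
  by apply: mulf_neq0; [exact: expf_neq0|exact: mulf_neq0].
- by apply/sec_neq0P; exists i, x; rewrite sec_valZ mulf_neq0 ?expf_neq0.
move=> {hres hx resx} i' x'; rewrite [LHS]/= [RHS]/=.
by field; rewrite ?pnatr_eq0.
Qed.

End LeadingTerms.

Section GeneralSections.
Variables (R : realType) (d : nat) (B : compact_complex_manifold R d).
Variable L : line_bundle B.
Local Notation V := (section L 1 * section L 2 * section L 3 * section L 4)%type.

Lemma polynomial_residual i x :
  polynomial_function (fun v : V =>
    (v.1.1.2 ⊗ v.1.1.2 ⊗ residual v.1.1.1 v.1.1.2 v.1.2 v.2) i x).
Proof.
have Pk : polynomial_function (fun v : V => v.1.1.1 i x).
  exact: (polynomial_sec_val _ _ _ _ _ _ (fst \o (fst \o fst))).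
have Ph : polynomial_function (fun v : V => v.1.1.2 i x).
  exact: (polynomial_sec_val _ _ _ _ _ _ (snd \o (fst \o fst))).
have Pphi : polynomial_function (fun v : V => v.1.2 i x).
  exact: (polynomial_sec_val _ _ _ _ _ _ (snd \o fst)).
have Pgamma : polynomial_function (fun v : V => v.2 i x).
  exact: (polynomial_sec_val _ _ _ _ _ _ snd).
exact: (polynomial_mul (polynomial_mul Ph Ph) (polynomial_mul
  (polynomial_add Ph (polynomial_opp _ _ _
    (polynomial_mul (polynomial_cst _ 4%:R) (polynomial_mul Pk Pk))))
  (polynomial_add (polynomial_mul Pphi Pphi)
    (polynomial_opp _ _ _ (polynomial_mul Ph Pgamma))))).
Qed.

Lemma general_residual_neq0 :
  (exists (k : section L 1) (h : section L 2) (phi : section L 3)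
          (gamma : section L 4), h ⊗ h ⊗ residual k h phi gamma != 0) ->
  for_general (fun v : V =>
    v.1.1.2 ⊗ v.1.1.2 ⊗ residual v.1.1.1 v.1.1.2 v.1.2 v.2 != 0).
Proof.
move=> [k [h [phi [gamma /sec_neq0P[i [x hres]]]]]].
(* With the point fixed where the given quadruple does not vanish, the single polynomial [p] cuts
   out an open set that contains this quadruple. *)
pose p (v : V) := (v.1.1.2 ⊗ v.1.1.2 ⊗ residual v.1.1.1 v.1.1.2 v.1.2 v.2) i x.
exists [set v | p v != 0]%classic; split.
- exists [set p]%classic; split=> [_ ->|v]; first exact: polynomial_residual.
  by split=> [pv|[_ [-> //]]]; exists p.
- by exists (k, h, phi, gamma).
- by move=> v pv; apply/sec_neq0P; exists i, x.
Qed.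

End GeneralSections.

(** The constants precede [B] and [L], hence are universal. The existence premise excludes bundles
    with too few sections, for instance with [h] always zero, where the claimed leading term
    vanishes identically. *)
Theorem mainTheorem13 (R : realType) :
  exists cD cj : Cplx R, [/\ cD != 0, cj != 0 &
    forall (d : nat) (B : compact_complex_manifold R d) (L : line_bundle B),
      (forall (k : section L 1) (h : section L 2) (phi : section L 3)
              (gamma : section L 4),
         discriminant_asymptotics cD k h phi gamma /\
         (h ⊗ h ⊗ residual k h phi gamma != 0 ->
          j_asymptotics cj k h phi gamma)) /\
      ((exists (k : section L 1) (h : section L 2) (phi : section L 3)
               (gamma : section L 4), h ⊗ h ⊗ residual k h phi gamma != 0) ->
       for_general (fun s : section L 1 * section L 2 * section L 3 * section L 4 =>
         let: (k, h, phi, gamma) := s in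
         discriminant_asymptotics cD k h phi gamma /\
         j_asymptotics cj k h phi gamma))].
Proof.
exists 16%:R, (- 432%:R^-1); split=> [||d B L].
- by rewrite pnatr_eq0.
- by rewrite oppr_eq0 invr_eq0 pnatr_eq0.
split=> [k h phi gamma|/general_residual_neq0[U [openU U0 Ures]]].
  by split; [exact: discriminant_leading_order|exact: j_leading_order].
exists U; split=> // -[[[k h] phi] gamma] /Ures hres.
by split; [exact: discriminant_leading_order|exact: j_leading_order].
Qed.
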